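(* Let $m\leqslant n$, let $A\in\mathbb{R}^{n\times n}$ be nonsymmetric positive definite and let $B\in\mathbb{R}^{m\times n}$ be rank-deficient. Also let $H\in\mathbb{R}^{n\times n}$ and $Q\in\mathbb{R}^{m\times m}$ be symmetric positive definite matrices. Let $\Gamma=\mathcal{M}^{-1}\mathcal{N}$ be the iteration matrix of the MGSS method. Then $\vartheta(\Gamma)<1$.
   Context: A (nonsymmetric) matrix $A\in\mathbb{R}^{n\times n}$ is called positive definite if $x^TAx>0$ for all $0\neq x\in\mathbb{R}^n$ (''nonsymmetric'' means symmetry is not assumed). ''$B$ is rank-deficient'' means $\mathrm{rank}(B)<m\leqslant n$. Define the block matrices $$\mathcal{A}=\begin{pmatrix}A & B^T\\ -B & 0\end{pmatrix},\quad \Omega=\begin{pmatrix}H&0\\0&Q\end{pmatrix},\quad \mathcal{M}=\tfrac12(\Omega+\mathcal{A}),\quad \mathcal{N}=\tfrac12(\Omega-\mathcal{A}),$$ so that $\mathcal{A}=\mathcal{M}-\mathcal{N}$; the matrix $\mathcal{M}$ is nonsingular. The MGSS (modified generalized shift-splitting) method for $\mathcal{A}u=b$ is the iteration $\mathcal{M}u^{(k+1)}=\mathcal{N}u^{(k)}+b$. The pseudo-spectral radius of $\Gamma$ is $\vartheta(\Gamma)=\max\{|\lambda| : \lambda\in\sigma(\Gamma),\ \lambda\neq 1\}$, where $\sigma(\Gamma)$ is the (complex) spectrum of $\Gamma$. *)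

(* Defs.v *)
From mathcomp Require Import all_boot all_order all_algebra.
From mathcomp Require Import reals.
From mathcomp.real_closed Require Import complex.

Set Implicit Arguments.
Unset Strict Implicit.
Unset Printing Implicit Defensive.

Import Order.TTheory GRing.Theory Num.Theory.
Local Open Scope ring_scope.

(* Symmetry of A is not part of the definition. *)
Definition posdefmx (R : numDomainType) (n : nat) (A : 'M[R]_n) : Prop :=
  forall x : 'cV[R]_n, x != 0 -> 0 < (x^T *m A *m x) 0 0.

Definition saddle_mx (R : pzRingType) (m n : nat)
    (A : 'M[R]_n) (B : 'M[R]_(m, n)) : 'M[R]_(n + m) :=
  block_mx A B^T (- B) 0.

Definition shift_mx (R : pzRingType) (m n : nat)
    (H : 'M[R]_n) (Q : 'M[R]_m) : 'M[R]_(n + m) :=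
  block_mx H 0 0 Q.

Section MGSS.
Variables (R : fieldType) (m n : nat).
Variables (A : 'M[R]_n) (B : 'M[R]_(m, n)) (H : 'M[R]_n) (Q : 'M[R]_m).

Definition MGSS_M : 'M[R]_(n + m) := 2^-1 *: (shift_mx H Q + saddle_mx A B).

Definition MGSS_N : 'M[R]_(n + m) := 2^-1 *: (shift_mx H Q - saddle_mx A B).

Definition MGSS_iteration_mx : 'M[R]_(n + m) := invmx MGSS_M *m MGSS_N.

End MGSS.

Section Spectrum.
Variables (R : rcfType) (k : nat).
Implicit Type G : 'M[R]_k.

(* The complex roots of the characteristic polynomial, repeated according to
   algebraic multiplicity. *)
Definition spectrum G : seq R[i] :=
  sval (closed_field_poly_normal (char_poly (map_mx (real_complex R) G))).

Lemma mem_spectrum G (l : R[i]) :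
  (l \in spectrum G) = eigenvalue (map_mx (real_complex R) G) l.
Proof.
rewrite eigenvalue_root_char /spectrum.
case: closed_field_poly_normal => s /= ->.
by rewrite (monicP (char_poly_monic _)) scale1r root_prod_XsubC.
Qed.

(* eigenvalue is about row vectors; column vectors give the same spectrum. *)
Lemma spectrumP G (l : R[i]) :
  reflect (exists2 v : 'cV[R[i]]_k,
             map_mx (real_complex R) G *m v = l *: v & v != 0)
          (l \in spectrum G).
Proof.
set GC := map_mx _ G.
have -> : (l \in spectrum G) = eigenvalue GC^T l.
  rewrite mem_spectrum !eigenvalue_root_char; congr (root _ l).
  by rewrite /char_poly -[LHS]det_tr linearB /= tr_scalar_mx map_trmx.
apply: (iffP eigenvalueP) => [[v Gv v0] | [v Gv v0]]; exists v^T.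
- by rewrite -[GC]trmxK -trmx_mul Gv linearZ.
- by rewrite trmx_eq0.
- by rewrite -trmx_mul Gv linearZ.
- by rewrite trmx_eq0.
Qed.

(* The maximum over the empty set is 0 by convention. *)
Definition pseudo_spectral_radius G : R :=
  \big[Num.max/0]_(l <- spectrum G | l != 1) ComplexField.Normc.normc l.

Lemma pseudo_spectral_radius_ge G (l : R[i]) :
  l \in spectrum G -> l != 1 ->
  ComplexField.Normc.normc l <= pseudo_spectral_radius G.
Proof. by move=> lG l1; apply: le_bigmax_seq. Qed.

Lemma pseudo_spectral_radius_attained G :
  has (fun l => l != 1) (spectrum G) ->
  exists l : R[i], [/\ l \in spectrum G, l != 1 &
    pseudo_spectral_radius G = ComplexField.Normc.normc l].
Proof.
have nc0 (z : R[i]) : 0 <= ComplexField.Normc.normc z.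
  by case: z => a b; apply: sqrtr_ge0.
rewrite /pseudo_spectral_radius; elim: (spectrum G) => //= l s IHs.
rewrite big_cons; have [l1 /= hs | l1 _] := eqVneq l 1.
  by have [z [zs z1 ->]] := IHs hs; exists z; rewrite inE zs orbT.
have [hs | hs] := boolP (has (fun l => l != 1) s); last first.
  exists l; rewrite mem_head l1; split=> //.
  by rewrite big_hasC // max_l.
have [z [zs z1 ->]] := IHs hs.
have [le_lz | lt_zl] := leP (ComplexField.Normc.normc l)
  (ComplexField.Normc.normc z).
- by exists z; rewrite inE zs orbT.
- by exists l; rewrite mem_head.
Qed.

End Spectrum.

(* Main.v *)
Require Import Defs.
From mathcomp Require Import all_boot all_order all_algebra.
From mathcomp Require Import reals.
From mathcomp.real_closed Require Import complex.
From mathcomp Require Import ring lra.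

Import Order.TTheory GRing.Theory Num.Theory.
Local Open Scope ring_scope.

(** Write [W] and [S] for the shift and saddle-point matrices. If [w = lambda v]
    is the image of the eigenvector [v] under the iteration matrix, then
    [W (v - w) = S (v + w)]; pairing with [v + w] and taking real parts gives
    [(1 - |lambda|^2) v^* W v = Re ((v + w)^* S (v + w))]. The right-hand side
    only sees the first block [x] of [v], through [A], so it is nonnegative. If
    [|lambda| >= 1], then [(1 + lambda) x = 0]; the second block row then gives
    [(1 - lambda) Q y = 0], hence [y = 0] as [lambda <> 1], and the first one
    gives [(1 - lambda) H x = 0], hence [v = 0]. *)

Definition qform {R : pzRingType} {n : nat} (K : 'M[R]_n) (x : 'cV[R]_n) : R :=
  (x^T *m K *m x) 0 0.

(* Unlike [mxE], does not expand matrix products into sums. *)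
Lemma entry_linearE (R : pzRingType) (m n : nat) (i : 'I_m) (j : 'I_n) :
  (forall X Y : 'M[R]_(m, n), (X + Y) i j = X i j + Y i j) *
  (forall X : 'M[R]_(m, n), (- X) i j = - X i j) *
  (forall d (X : 'M[R]_(m, n)), (d *: X) i j = d * X i j).
Proof. by do !split=> *; rewrite mxE. Qed.

Lemma symmetricmx_tr (R : fieldType) (n : nat) (W : 'M[R]_n) :
  W \is symmetricmx -> W^T = W.
Proof. by move=> /is_hermitianmxP {2}->; rewrite expr0 scale1r map_mx_id. Qed.

(** A 1 by 1 matrix equals its own transpose. *)
Lemma mulmx_tr_symmetric (R : comPzRingType) (n : nat) (W : 'M[R]_n)
    (x y : 'cV[R]_n) :
  W^T = W -> (x^T *m W *m y) 0 0 = (y^T *m W *m x) 0 0.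
Proof.
move=> Wsym.
have -> : x^T *m W *m y = (y^T *m W *m x)^T.
  by rewrite !trmx_mul trmxK mulmxA Wsym.
by rewrite mxE.
Qed.

(** Pair the hypothesis with [p + r]: by symmetry of [W], the cross terms of [(p + r)^T W (p - r)]
    cancel. *)
Lemma qform_energy (R : comPzRingType) (n : nat) (W S : 'M[R]_n)
    (p r : 'cV[R]_n) :
  W^T = W -> W *m (p - r) = S *m (p + r) ->
  qform W p - qform W r = qform S (p + r).
Proof.
move=> Wsym e; have c := mulmx_tr_symmetric R n W p r Wsym.
rewrite /qform -[_ *m S *m _]mulmxA -e linearD /= mulmxDl !mulmxBr !mulmxA.
by rewrite !entry_linearE c; ring.
Qed.

(** The arguments on the left are the real and imaginary parts of [(a + ib)(p + iq)], so this is
    [(lambda v)^* W (lambda v) = |lambda|^2 v^* W v] in real terms. *)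
Lemma qform_rotate (R : comPzRingType) (n : nat) (W : 'M[R]_n) (a b : R)
    (p q : 'cV[R]_n) :
  W^T = W ->
  qform W (a *: p - b *: q) + qform W (a *: q + b *: p)
    = (a ^+ 2 + b ^+ 2) * (qform W p + qform W q).
Proof.
move=> Wsym; have c := mulmx_tr_symmetric R n W p q Wsym.
rewrite /qform !linearD !linearN !linearZ /= !(mulmxDl, mulmxDr, mulmxN, mulNmx).
rewrite -!(scalemxAl, scalemxAr) !mulNmx.
by rewrite !entry_linearE c; ring.
Qed.

(** * Block structure of the shift and saddle-point matrices *)

Lemma saddle_mx_col (R : pzRingType) (m n : nat) (A : 'M[R]_n)
    (B : 'M[R]_(m, n)) (x : 'cV[R]_n) (y : 'cV[R]_m) :
  saddle_mx A B *m col_mx x y = col_mx (A *m x + B^T *m y) (- B *m x).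
Proof. by rewrite /saddle_mx mul_block_col mul0mx addr0. Qed.

Lemma shift_mx_col (R : pzRingType) (m n : nat) (H : 'M[R]_n) (Q : 'M[R]_m)
    (x : 'cV[R]_n) (y : 'cV[R]_m) :
  shift_mx H Q *m col_mx x y = col_mx (H *m x) (Q *m y).
Proof. by rewrite /shift_mx mul_block_col !mul0mx addr0 add0r. Qed.

(** The blocks [B^T] and [- B] contribute opposite scalars, which cancel. *)
Lemma qform_saddle (R : comPzRingType) (m n : nat) (A : 'M[R]_n)
    (B : 'M[R]_(m, n)) (x : 'cV[R]_n) (y : 'cV[R]_m) :
  qform (saddle_mx A B) (col_mx x y) = qform A x.
Proof.
rewrite /qform /saddle_mx tr_col_mx mul_row_block mul_row_col mulmx0 addr0.
rewrite mulmxDl mulmxN mulNmx.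
have -> : x^T *m B^T *m y = (y^T *m B *m x)^T by rewrite !trmx_mul trmxK mulmxA.
by rewrite !mxE addrNK.
Qed.

Lemma qform_shift (R : comPzRingType) (m n : nat) (H : 'M[R]_n) (Q : 'M[R]_m)
    (x : 'cV[R]_n) (y : 'cV[R]_m) :
  qform (shift_mx H Q) (col_mx x y) = qform H x + qform Q y.
Proof.
rewrite /qform /shift_mx tr_col_mx mul_row_block mul_row_col !mulmx0.
by rewrite addr0 add0r mxE.
Qed.

Lemma shift_mx_sym (R : pzRingType) (m n : nat) (H : 'M[R]_n) (Q : 'M[R]_m) :
  H^T = H -> Q^T = Q -> (shift_mx H Q)^T = shift_mx H Q.
Proof. by move=> hH hQ; rewrite /shift_mx tr_block_mx !trmx0 hH hQ. Qed.

(** * Consequences of positive definiteness *)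

Lemma posdefmx_ge0 (R : numDomainType) (n : nat) (K : 'M[R]_n) (x : 'cV[R]_n) :
  posdefmx K -> 0 <= qform K x.
Proof.
move=> hK; have [->|x0] := eqVneq x 0; last exact/ltW/hK.
by rewrite /qform mulmx0 mxE.
Qed.

Lemma posdefmx_eq0 (R : numDomainType) (n : nat) (K : 'M[R]_n) (x : 'cV[R]_n) :
  posdefmx K -> qform K x <= 0 -> x = 0.
Proof.
move=> hK hx; apply/eqP; apply: contraTT hx => x0.
by rewrite lt_geF //; apply: hK.
Qed.

Lemma posdefmx_mul_eq0 (R : numDomainType) (n : nat) (K : 'M[R]_n)
    (x : 'cV[R]_n) :
  posdefmx K -> K *m x = 0 -> x = 0.
Proof.
move=> hK Kx; apply: (posdefmx_eq0 R n K) => //.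
by rewrite /qform -mulmxA Kx mulmx0 mxE.
Qed.

Lemma posdefmx_unit (R : numFieldType) (n : nat) (K : 'M[R]_n) :
  posdefmx K -> K \in unitmx.
Proof.
move=> hK; rewrite -row_free_unit; apply: inj_row_free => v vK.
apply: trmx_inj; rewrite trmx0; apply: (posdefmx_eq0 R n K) => //.
by rewrite /qform trmxK vK mul0mx mxE.
Qed.

Lemma shift_mx_posdef (R : numDomainType) (m n : nat) (H : 'M[R]_n)
    (Q : 'M[R]_m) :
  posdefmx H -> posdefmx Q -> posdefmx (shift_mx H Q).
Proof.
move=> hH hQ u; rewrite -[u]vsubmxK -/(qform _ _) qform_shift.
set x := usubmx u; set y := dsubmx u; rewrite col_mx_eq0 negb_and.
case/orP=> [x0 | y0].
- by apply: ltr_wpDr; [exact: posdefmx_ge0 | exact: hH].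
- by apply: ltr_wpDl; [exact: posdefmx_ge0 | exact: hQ].
Qed.

(** With [lambda = a + ib], the equations say [(1 - lambda)(u + iv) = 0]. Multiplying by the
    conjugate [(1 - a) + ib] leaves the nonzero real factor [|1 - lambda|^2]. *)
Lemma rotate_fixed_eq0 (R : realFieldType) (k : nat) (a b : R)
    (u v : 'cV[R]_k) :
  (a != 1) || (b != 0) ->
  u - (a *: u - b *: v) = 0 -> v - (a *: v + b *: u) = 0 -> u = 0 /\ v = 0.
Proof.
move=> l1 e1 e2.
have d0 : (1 - a) ^+ 2 + b ^+ 2 != 0.
  by rewrite paddr_eq0 ?sqr_ge0 // !sqrf_eq0 subr_eq0 eq_sym negb_and.
have f1 i : u i 0 - (a * u i 0 - b * v i 0) = 0.
  by move/colP: e1 => /(_ i); rewrite !mxE.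
have f2 i : v i 0 - (a * v i 0 + b * u i 0) = 0.
  by move/colP: e2 => /(_ i); rewrite !mxE.
split; apply/colP => i; apply: (mulfI d0); rewrite mxE mulr0.
- transitivity ((1 - a) * (u i 0 - (a * u i 0 - b * v i 0))
                - b * (v i 0 - (a * v i 0 + b * u i 0))); first by ring.
  by rewrite f1 f2 !mulr0 subrr.
- transitivity (b * (u i 0 - (a * u i 0 - b * v i 0))
                + (1 - a) * (v i 0 - (a * v i 0 + b * u i 0))); first by ring.
  by rewrite f1 f2 !mulr0 addr0.
Qed.

(** * The MGSS iteration in real arithmetic *)

Section Iteration.
Context {R : realFieldType} {m n : nat}.
Variables (A : 'M[R]_n) (B : 'M[R]_(m, n)) (H : 'M[R]_n) (Q : 'M[R]_m).
Hypotheses (hA : posdefmx A) (hH : posdefmx H) (hQ : posdefmx Q).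

(** Up to the factor 1/2, the quadratic form is that of the positive definite shift matrix plus the
    nonnegative one of the saddle-point matrix. *)
Lemma MGSS_M_unit : MGSS_M A B H Q \in unitmx.
Proof.
rewrite /MGSS_M unitmxZ ?unitfE ?invr_eq0 ?pnatr_eq0 //.
apply: posdefmx_unit => u u0.
rewrite mulmxDr mulmxDl mxE; apply: ltr_wpDr.
  by rewrite -/(qform _ _) -[u]vsubmxK qform_saddle; apply: posdefmx_ge0.
exact: shift_mx_posdef.
Qed.

Lemma MGSS_iteration_mxE (p r : 'cV[R]_(n + m)) :
  MGSS_iteration_mx A B H Q *m p = r ->
  shift_mx H Q *m (p - r) = saddle_mx A B *m (p + r).
Proof.
move=> <-; set r' := _ *m p.
have : MGSS_N A B H Q *m p = MGSS_M A B H Q *m r'.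
  by rewrite /r' /MGSS_iteration_mx !mulmxA mulmxV ?mul1mx ?MGSS_M_unit.
rewrite /MGSS_N /MGSS_M -!scalemxAl => /scalerI.
rewrite invr_eq0 pnatr_eq0 => /(_ isT) e.
apply/eqP; rewrite -subr_eq0 mulmxBr mulmxDr.
move/eqP: e; rewrite mulmxBl mulmxDl -subr_eq0 => /eqP <-; apply/eqP.
by rewrite !opprD !addrA; congr (_ - _); rewrite addrAC.
Qed.

(** The eigenvalue equation is split into real and imaginary parts so that the whole argument runs
    over an ordered field. *)
Lemma MGSS_real_eigen (a b : R) (p q : 'cV[R]_(n + m)) :
  H^T = H -> Q^T = Q ->
  MGSS_iteration_mx A B H Q *m p = a *: p - b *: q ->
  MGSS_iteration_mx A B H Q *m q = a *: q + b *: p ->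
  (p != 0) || (q != 0) -> (a != 1) || (b != 0) ->
  a ^+ 2 + b ^+ 2 < 1.
Proof.
move=> sH sQ /MGSS_iteration_mxE ep /MGSS_iteration_mxE eq v0 l1.
rewrite ltNge; apply/negP => ab.
have sW := shift_mx_sym R m n H Q sH sQ.
have hW := shift_mx_posdef R m n H Q hH hQ.
have rot := qform_rotate R _ _ a b p q sW.
have := qform_energy R _ _ _ _ _ sW eq; have := qform_energy R _ _ _ _ _ sW ep.
have Wp := posdefmx_ge0 R _ _ p hW; have Wq := posdefmx_ge0 R _ _ q hW.
(* The eigenvector is [v = p + iq], with blocks [x1 + i x2] and [y1 + i y2]. *)
move: ep eq v0; rewrite -[p]vsubmxK -[q]vsubmxK in rot Wp Wq *.
move: (usubmx p) (dsubmx p) (usubmx q) (dsubmx q) rot Wp Wq.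
move=> x1 y1 x2 y2 rot Wp Wq.
have fixed0 (k : nat) (K : 'M[R]_k) (u1 u2 : 'cV[R]_k) : posdefmx K ->
    K *m (u1 - (a *: u1 - b *: u2)) = 0 ->
    K *m (u2 - (a *: u2 + b *: u1)) = 0 -> u1 = 0 /\ u2 = 0.
  move=> hK /(posdefmx_mul_eq0 _ _ _ _ hK) e1 /(posdefmx_mul_eq0 _ _ _ _ hK) e2.
  exact: (rotate_fixed_eq0 R k a b).
rewrite !scale_col_mx !(opp_col_mx, add_col_mx) !qform_saddle.
rewrite !scale_col_mx !(opp_col_mx, add_col_mx) in rot.
rewrite !shift_mx_col !saddle_mx_col.
move=> /eq_col_mx[ep1 ep2] /eq_col_mx[eq1 eq2] v0 Ep Eq.
(* By [Ep], [Eq] and [rot], the two forms add up to [(1 - |lambda|^2) v^* W v <= 0]; as both are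
   nonnegative, neither can be positive. *)
have [A1 A2] : qform A (x1 + (a *: x1 - b *: x2)) <= 0 /\
               qform A (x2 + (a *: x2 + b *: x1)) <= 0.
  have g1 := posdefmx_ge0 R _ _ (x1 + (a *: x1 - b *: x2)) hA.
  have g2 := posdefmx_ge0 R _ _ (x2 + (a *: x2 + b *: x1)) hA.
  by split; nra.
have z1 := posdefmx_eq0 _ _ _ _ hA A1; have z2 := posdefmx_eq0 _ _ _ _ hA A2.
rewrite z1 mulmx0 in ep2; rewrite z2 mulmx0 in eq2.
have [y10 y20] := fixed0 _ Q y1 y2 hQ ep2 eq2.
rewrite z1 y10 y20 !scaler0 subrr addr0 !mulmx0 addr0 in ep1.
rewrite z2 y10 y20 !scaler0 !addr0 !mulmx0 addr0 in eq1.
have [x10 x20] := fixed0 _ H x1 x2 hH ep1 eq1.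
by move: v0; rewrite x10 x20 y10 y20 col_mx0 eqxx.
Qed.

End Iteration.

(** * Real and imaginary parts of complex vectors *)

Section RealImaginary.
Context {R : rcfType} {k : nat}.
Implicit Types (K : 'M[R]_k) (v : 'cV[R[i]]_k) (l : R[i]).

Lemma Re_real_mulmx K v :
  map_mx (@complex.Re R) (map_mx (real_complex R) K *m v)
    = K *m map_mx (@complex.Re R) v.
Proof.
apply/colP => i; rewrite !mxE raddf_sum; apply: eq_bigr => j _.
by rewrite !mxE; case: (v j 0) => c d /=; rewrite mul0r subr0.
Qed.

Lemma Im_real_mulmx K v :
  map_mx (@complex.Im R) (map_mx (real_complex R) K *m v)
    = K *m map_mx (@complex.Im R) v.
Proof.
apply/colP => i; rewrite !mxE raddf_sum; apply: eq_bigr => j _.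
by rewrite !mxE; case: (v j 0) => c d /=; rewrite mul0r addr0.
Qed.

Lemma Re_scalemx l v :
  map_mx (@complex.Re R) (l *: v)
    = complex.Re l *: map_mx (@complex.Re R) v
      - complex.Im l *: map_mx (@complex.Im R) v.
Proof. by apply/colP => i; rewrite !mxE; case: l (v i 0) => [a b] [c d]. Qed.

Lemma Im_scalemx l v :
  map_mx (@complex.Im R) (l *: v)
    = complex.Re l *: map_mx (@complex.Im R) v
      + complex.Im l *: map_mx (@complex.Re R) v.
Proof.
by apply/colP => i; rewrite !mxE; case: l (v i 0) => [a b] [c d].
Qed.

Lemma ReIm_mx_neq0 v :
  v != 0 ->
  (map_mx (@complex.Re R) v != 0) || (map_mx (@complex.Im R) v != 0).
Proof.
apply: contraR; rewrite negb_or !negbK => /andP[/eqP/colP r0 /eqP/colP i0].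
apply/eqP/colP => i; move: (r0 i) (i0 i); rewrite !mxE.
by case: (v i 0) => c d /= -> ->.
Qed.

End RealImaginary.

Theorem theorem1 (R : realType) (m n : nat) (hmn : (m <= n)%N)
    (A : 'M[R]_n) (B : 'M[R]_(m, n)) (H : 'M[R]_n) (Q : 'M[R]_m)
    (hA : posdefmx A)
    (hB : (\rank B < m)%N)
    (hHsym : H \is symmetricmx) (hH : posdefmx H)
    (hQsym : Q \is symmetricmx) (hQ : posdefmx Q) :
  pseudo_spectral_radius (MGSS_iteration_mx A B H Q) < 1.
Proof.
set G := MGSS_iteration_mx A B H Q.
(* If 1 is the only eigenvalue, or there is none, the maximum takes its default value 0. *)
have [/pseudo_spectral_radius_attained [l [lG l1 ->]] | no] :=
  boolP (has (fun l => l != 1) (spectrum G)); last first.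
  by rewrite /pseudo_spectral_radius big_hasC // ltr01.
have [v Gv v0] := spectrumP _ _ lG.
have Gp := congr1 (map_mx (@complex.Re R)) Gv.
have Gq := congr1 (map_mx (@complex.Im R)) Gv.
rewrite Re_real_mulmx Re_scalemx in Gp; rewrite Im_real_mulmx Im_scalemx in Gq.
have l1' : (complex.Re l != 1) || (complex.Im l != 0).
  by move: l1; rewrite eq_complex /= negb_and.
have := MGSS_real_eigen A B H Q hA hH hQ _ _ _ _ (symmetricmx_tr _ _ _ hHsym)
  (symmetricmx_tr _ _ _ hQsym) Gp Gq
  (ReIm_mx_neq0 v v0) l1'.
(* The modulus is the square root of [a ^+ 2 + b ^+ 2]. *)
by case: (l) => a b /= ab; rewrite -sqrtr1 ltr_sqrt.
Qed.
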